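(* Let $\mathbf{e}$ be a transitive relation on a finite set $E$. The following are equivalent: (i) $\mathrm{Reg}(\mathbf{e})$ is a bounded homomorphic image of a free lattice; (ii) $\mathrm{Reg}(\mathbf{e})$ is semidistributive; (iii) $\mathrm{Reg}(\mathbf{e})$ is pseudocomplemented; (iv) every connected component $C$ of the preordering $\unlhd$ is such that either the restriction of $\mathbf{e}$ to $C$ is antisymmetric, or $C=\{a,b\}$ with $a\neq b$, $(a,b)\in\mathbf{e}$ and $(b,a)\in\mathbf{e}$.
   Context: $\mathbf{e}$ is viewed as a set of ordered pairs; $x\unlhd y$ means $(x,y)\in\mathbf{e}$ or $x=y$ (a preordering); its connected components are those of the undirected graph on $E$ joining $x,y$ whenever $x\unlhd y$. Antisymmetric: $(x,y),(y,x)\in\mathbf{e}$ imply $x=y$. A subset $\mathbf{a}\subseteq\mathbf{e}$ is closed if transitive, open if $\mathbf{e}\setminus\mathbf{a}$ is transitive; $\mathrm{cl}$ is transitive closure, $\mathrm{int}(\mathbf{a})$ the largest open subset; regular closed means $\mathbf{a}=\mathrm{cl}(\mathrm{int}(\mathbf{a}))$. $\mathrm{Reg}(\mathbf{e})$ is the lattice of regular closed subsets under inclusion (join $\mathrm{cl}(\bigcup)$, meet $\mathrm{cl}(\mathrm{int}(\bigcap))$). A lattice $L$ is a bounded homomorphic image of a free lattice if there is a free lattice $F$ and a surjective lattice homomorphism $f:F\to L$ such that each $f^{-1}\{x\}$ has a least and a largest element. $L$ is join-semidistributive if $x\vee z=y\vee z$ implies $x\vee z=(x\wedge y)\vee z$,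 meet-semidistributive dually, and semidistributive if both. $L$ with least element $0$ is pseudocomplemented if each $\{y: x\wedge y=0\}$ has a greatest element. *)

(* Defs.v *)
From HB Require Import structures.
From mathcomp Require Import all_boot all_order.

Set Implicit Arguments.
Unset Strict Implicit.
Unset Printing Implicit Defensive.

Import Order.TTheory.
Local Open Scope order_scope.

Section TransitiveRelations.
Variable E : finType.
Implicit Types a b e : {set E * E}.

Definition set_transitive a : bool :=
  [forall x, forall y, forall z,
     ((x, y) \in a) ==> ((y, z) \in a) ==> ((x, z) \in a)].

Lemma set_transitiveP a :
  reflect (transitive [rel x y | (x, y) \in a]) (set_transitive a).
Proof.
apply: (iffP forallP) => [h y x z /= xy yz | h x].
  by move/forallP: (h x) => /(_ y)/forallP/(_ z)/implyP/(_ xy)/implyP/(_ yz).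
apply/forallP=> y; apply/forallP=> z; apply/implyP=> xy; apply/implyP=> yz.
exact: h xy yz.
Qed.

Definition cl a : {set E * E} :=
  \bigcap_(b : {set E * E} | set_transitive b && (a \subset b)) b.

Definition is_open e a : bool := (a \subset e) && set_transitive (e :\: a).

Definition interior e a : {set E * E} :=
  \bigcup_(b : {set E * E} | is_open e b && (b \subset a)) b.

Definition regular_closed e a : bool :=
  (a \subset e) && (a == cl (interior e a)).

Lemma sub_cl a : a \subset cl a.
Proof. by apply/bigcapsP=> b /andP[]. Qed.

Lemma cl_sub a b : set_transitive b -> a \subset b -> cl a \subset b.
Proof. by move=> tb ab; apply: bigcap_inf; rewrite tb. Qed.

Lemma cl_transitive a : set_transitive (cl a).
Proof.
apply/set_transitiveP => y x z /= /bigcapP xy /bigcapP yz.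
apply/bigcapP => b hb; have /andP[/set_transitiveP tb _] := hb.
by apply: (tb y); [apply: xy | apply: yz].
Qed.

Lemma clS a b : a \subset b -> cl a \subset cl b.
Proof.
by move=> ab; rewrite cl_sub ?cl_transitive // (subset_trans ab) ?sub_cl.
Qed.

Lemma cl_id a : set_transitive a -> cl a = a.
Proof. by move=> ta; apply/eqP; rewrite eqEsubset sub_cl cl_sub. Qed.

Lemma int_sub e a : interior e a \subset a.
Proof. by apply/bigcupsP=> b /andP[]. Qed.

Lemma sub_int e a b : is_open e b -> b \subset a -> b \subset interior e a.
Proof. by move=> ob ba; apply: bigcup_sup; rewrite ob. Qed.

Lemma int_open e a : set_transitive e -> is_open e (interior e a).
Proof.
move=> /set_transitiveP te; apply/andP; split.
  by apply/bigcupsP=> b /andP[/andP[]].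
apply/set_transitiveP => y x z /=; rewrite !in_setD.
move=> /andP[xyN xye] /andP[yzN yze]; have {te} xze : (x, z) \in e := te y x z xye yze.
rewrite xze andbT.
apply/bigcupP => -[b hb xzb].
have /andP[/andP[_ /set_transitiveP tb] _] := hb.
have xyb : (x, y) \notin b by apply: contra xyN => xyb; apply/bigcupP; exists b.
have yzb : (y, z) \notin b by apply: contra yzN => yzb; apply/bigcupP; exists b.
by have /(_ y x z) /= := tb; rewrite !in_setD xyb yzb xye yze xzb; move/(_ isT isT).
Qed.

Lemma intS e a b : set_transitive e -> a \subset b -> interior e a \subset interior e b.
Proof.
by move=> te ab; rewrite sub_int ?int_open // (subset_trans _ ab) ?int_sub.
Qed.

Lemma int_id e a : is_open e a -> interior e a = a.
Proof. by move=> oa; apply/eqP; rewrite eqEsubset int_sub sub_int. Qed.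

Lemma regular_closed_trans e a : regular_closed e a -> set_transitive a.
Proof. by case/andP=> _ /eqP->; apply: cl_transitive. Qed.

Lemma cl_int_regular e a : set_transitive e -> regular_closed e (cl (interior e a)).
Proof.
move=> te; apply/andP; split.
  by rewrite cl_sub //; case/andP: (int_open a te).
rewrite eqEsubset clS ?sub_int ?int_open ?sub_cl //=.
by rewrite cl_sub ?cl_transitive ?int_sub.
Qed.

Lemma clU_regular e a b : set_transitive e ->
  regular_closed e a -> regular_closed e b -> regular_closed e (cl (a :|: b)).
Proof.
move=> te /andP[ae /eqP ea] /andP[be /eqP eb]; apply/andP; split.
  by rewrite cl_sub // subUset ae.
rewrite eqEsubset; apply/andP; split; apply: cl_sub; rewrite ?cl_transitive //.
  rewrite subUset; apply/andP; split.
    rewrite {1}ea; apply/clS/intS => //.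
    by rewrite (subset_trans _ (sub_cl _)) ?subsetUl.
  rewrite {1}eb; apply/clS/intS => //.
  by rewrite (subset_trans _ (sub_cl _)) ?subsetUr.
exact: int_sub.
Qed.

Lemma regular0 e : set_transitive e -> regular_closed e set0.
Proof.
move=> te; apply/andP; split; first exact: sub0set.
have -> : interior e set0 = set0 by apply/eqP; rewrite -subset0 int_sub.
rewrite cl_id //; apply/set_transitiveP => y x z /=; by rewrite inE.
Qed.

Lemma regularT e : set_transitive e -> regular_closed e e.
Proof.
move=> te; have oe : is_open e e.
  rewrite /is_open subxx setDv; apply/set_transitiveP => y x z /=.
  by rewrite inE.
by rewrite /regular_closed subxx (int_id oe) cl_id /=.
Qed.

Definition trile e : rel E := [rel x y | ((x, y) \in e) || (x == y)].

Definition component e (x : E) : {set E} :=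
  [set y | connect [rel u v | trile e u v || trile e v u] x y].

Definition components e : {set {set E}} := [set component e x | x : E].

Definition restriction e (C : {set E}) : {set E * E} := e :&: setX C C.

Definition set_antisymmetric a : Prop :=
  forall x y, (x, y) \in a -> (y, x) \in a -> x = y.

End TransitiveRelations.

(* The transitivity proof is a parameter of the type because the lattice
   structure depends on it: without it, cl (a :|: b) need not be included in e. *)
Definition Reg (E : finType) (e : {set E * E}) (te : set_transitive e) : Type :=
  {a : {set E * E} | regular_closed e a}.

Fact reg_display : Order.disp_t. Proof. exact: Order.Disp tt tt. Qed.

Section RegLattice.
Variables (E : finType) (e : {set E * E}) (te : set_transitive e).

HB.instance Definition _ :=
  Finite.copy (Reg te) {a : {set E * E} | regular_closed e a}.

Implicit Types a b c : Reg te.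

Definition reg_le a b := val a \subset val b.
Definition reg_join a b : Reg te :=
  Sub (cl (val a :|: val b)) (clU_regular te (valP a) (valP b)).
Definition reg_meet a b : Reg te :=
  Sub (cl (interior e (val a :&: val b))) (cl_int_regular (val a :&: val b) te).
Definition reg_bot : Reg te := Sub set0 (regular0 te).
Definition reg_top : Reg te := Sub e (regularT te).

Fact reg_le_refl : reflexive reg_le.
Proof. by move=> a; apply: subxx. Qed.

Fact reg_le_anti : antisymmetric reg_le.
Proof. by move=> a b ab; apply/val_inj/eqP; rewrite eqEsubset. Qed.

Fact reg_le_trans : transitive reg_le.
Proof. by move=> b a c; apply: subset_trans. Qed.

HB.instance Definition _ := Order.Le_isPOrder.Build reg_display (Reg te)
  reg_le_refl reg_le_anti reg_le_trans.

Fact reg_meetP a b c : (a <= reg_meet b c) = (a <= b) && (a <= c).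
Proof.
rewrite /Order.le /= /reg_le -subsetI.
apply/idP/idP => [h | h].
  apply: subset_trans h _; rewrite subsetI.
  have [tb tc] := (regular_closed_trans (valP b), regular_closed_trans (valP c)).
  by rewrite !cl_sub // (subset_trans (int_sub _ _)) ?subsetIl ?subsetIr.
by case/andP: (valP a) => _ /eqP {1}->; apply/clS/intS.
Qed.

Fact reg_joinP a b c : (reg_join a b <= c) = (a <= c) && (b <= c).
Proof.
rewrite /Order.le /= /reg_le -subUset.
apply/idP/idP => [|h]; first exact/subset_trans/sub_cl.
exact: cl_sub (regular_closed_trans (valP c)) h.
Qed.

HB.instance Definition _ :=
  Order.POrder_MeetJoin_isLattice.Build reg_display (Reg te)
    reg_meetP reg_joinP.

Fact reg_le0x a : reg_bot <= a. Proof. exact: sub0set. Qed.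
Fact reg_lex1 a : a <= reg_top. Proof. by case/andP: (valP a). Qed.

HB.instance Definition _ :=
  Order.hasBottom.Build reg_display (Reg te) reg_le0x.
HB.instance Definition _ :=
  Order.hasTop.Build reg_display (Reg te) reg_lex1.

End RegLattice.

Section LatticeNotions.

Definition is_least (d : Order.disp_t) (T : porderType d) (P : T -> Prop)
  (m : T) : Prop := P m /\ forall x, P x -> m <= x.

Definition is_greatest (d : Order.disp_t) (T : porderType d) (P : T -> Prop)
  (m : T) : Prop := P m /\ forall x, P x -> x <= m.

Definition free_lattice (X : Type) (d : Order.disp_t) (F : latticeType d)
    (i : X -> F) : Prop :=
  forall (d' : Order.disp_t) (L : latticeType d') (g : X -> L),
  exists h : {lmorphism F -> L},
    h \o i =1 g /\
    forall h' : {lmorphism F -> L}, h' \o i =1 g -> h' =1 h.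

Definition bounded_image_of_free (d : Order.disp_t) (L : latticeType d) : Prop :=
  exists (X : Type) (d' : Order.disp_t) (F : latticeType d') (i : X -> F),
    free_lattice i /\
    exists f : {lmorphism F -> L},
      (forall y : L, exists x : F, f x = y) /\
      (forall y : L,
        (exists m, is_least (fun x : F => f x = y) m) /\
        (exists m, is_greatest (fun x : F => f x = y) m)).

Definition join_semidistributive (d : Order.disp_t) (L : latticeType d) : Prop :=
  forall x y z : L, x `|` z = y `|` z -> x `|` z = (x `&` y) `|` z.

Definition meet_semidistributive (d : Order.disp_t) (L : latticeType d) : Prop :=
  forall x y z : L, x `&` z = y `&` z -> x `&` z = (x `|` y) `&` z.

Definition semidistributive (d : Order.disp_t) (L : latticeType d) : Prop :=
  join_semidistributive L /\ meet_semidistributive L.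

Definition pseudocomplemented (d : Order.disp_t) (L : bLatticeType d) : Prop :=
  forall x : L, exists m, is_greatest (fun y : L => x `&` y = \bot) m.

End LatticeNotions.

(* Main.v *)
Require Import Defs.
From HB Require Import structures.
From mathcomp Require Import all_boot all_order.
From mathcomp Require Import boolp.

(** In a free lattice, Day's doubling of an interval yields Whitman's condition
    and the join primeness of the generators, and semidistributivity follows by
    induction on the generation of the elements. A surjection whose fibers have
    least elements has a lower adjoint, which preserves joins and so transfers
    join-semidistributivity to the image. In a finite meet-semidistributive
    lattice the join of all elements disjoint from [x] is disjoint from [x].

    The pairs of [e] leading from a set to its complement form a clopen
    relation. If [x] and [y] are equivalent and a third element is comparable to
    them, the relations given by [{x, y}], [{x}] and [{y}], or by the
    complements of these sets, violate pseudocomplementation. The condition on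
    components says that no such third element exists.

    In that case the size of intervals ranks the pairs of [e] so that a pair
    [(a, b)] has larger rank than [(a, c)] and [(c, b)] for every third element
    [c]. The clopen relations attached to pairs are join-dense in [Reg e], and a
    nontrivial join cover of one of them refines to relations of smaller rank.
    By recursion on ranks, a surjection from a finitely generated lattice onto
    [Reg e] has a lower adjoint; the dual automorphism sending [a] to
    [cl (e \ a)] provides an upper one. *)

Set Implicit Arguments.
Unset Strict Implicit.
Unset Printing Implicit Defensive.

Import Order.TTheory.
Local Open Scope order_scope.
Local Open Scope quotient_scope.

(** * Free lattices *)

Section LatticeMorphisms.
Variables (d d' : Order.disp_t) (L : latticeType d) (L' : latticeType d').
Variable f : L -> L'.
Hypothesis fI : {morph f : x y / x `&` y}.

Lemma meet_morph_homo : {homo f : x y / x <= y}.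
Proof. by move=> x y /meet_idPl xy; rewrite -xy fI leIr. Qed.

Hypothesis fU : {morph f : x y / x `|` y}.

Definition lmorphism_of : {lmorphism L -> L'} :=
  HB.pack f (Order.isOrderMorphism.Build _ _ _ _ f meet_morph_homo)
    (Order.isMeetLatticeMorphism.Build _ _ _ _ f fI)
    (Order.isJoinLatticeMorphism.Build _ _ _ _ f fU).

End LatticeMorphisms.

Section CompLatticeMorphism.
Variables (d d' d'' : Order.disp_t) (L : latticeType d) (L' : latticeType d').
Variables (L'' : latticeType d'').
Variables (f : {lmorphism L' -> L''}) (g : {lmorphism L -> L'}).

(* This joins the meet and join morphism structures on [f \o g], which the
   library declares separately. *)
HB.instance Definition _ := Order.JoinLatticeMorphism.on (f \o g).

End CompLatticeMorphism.

Definition generates (X : Type) (d : Order.disp_t) (L : latticeType d)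
    (g : X -> L) : Prop :=
  forall P : L -> Prop, (forall x, P (g x)) ->
    (forall y z, P y -> P z -> P (y `&` z)) ->
    (forall y z, P y -> P z -> P (y `|` z)) ->
  forall y, P y.

Lemma eq_lmorphism (X : Type) (d d' : Order.disp_t) (L : latticeType d)
    (L' : latticeType d') (g : X -> L) (h h' : {lmorphism L -> L'}) :
  generates g -> h \o g =1 h' \o g -> h =1 h'.
Proof.
move=> gen_g hg; elim/gen_g => [x | y z hy hz | y z hy hz]; first exact: hg.
- by rewrite !omorphI; congr (_ `&` _).
- by rewrite !omorphU; congr (_ `|` _).
Qed.

Inductive term (X : Type) : Type :=
| Var of X
| Meet of term X & term X
| Join of term X & term X.

HB.instance Definition _ (X : Type) := gen_eqMixin (term X).
HB.instance Definition _ (X : Type) := gen_choiceMixin (term X).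

Fixpoint eval (X : Type) (d : Order.disp_t) (L : latticeType d) (g : X -> L)
    (t : term X) : L :=
  match t with
  | Var x => g x
  | Meet t1 t2 => eval g t1 `&` eval g t2
  | Join t1 t2 => eval g t1 `|` eval g t2
  end.

Section FreeLattice.
Variable X : Type.
Implicit Types r s t : term X.

Definition term_le s t : bool :=
  `[< forall (d : Order.disp_t) (L : latticeType d) (g : X -> L),
        eval g s <= eval g t >].

Definition term_eqv s t := term_le s t && term_le t s.

Lemma term_le_refl : reflexive term_le.
Proof. by move=> t; apply/asboolP. Qed.

Lemma term_le_trans : transitive term_le.
Proof.
move=> s r t /asboolP rs /asboolP st; apply/asboolP => d L g.
exact: le_trans (rs d L g) (st d L g).
Qed.

Lemma term_eqv_refl : reflexive term_eqv.
Proof. by move=> t; rewrite /term_eqv term_le_refl. Qed.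

Lemma term_eqv_sym : symmetric term_eqv.
Proof. by move=> s t; apply: andbC. Qed.

Lemma term_eqv_trans : transitive term_eqv.
Proof.
move=> s r t /andP[rs sr] /andP[st ts].
by rewrite /term_eqv (term_le_trans rs st) (term_le_trans ts sr).
Qed.

Canonical term_eqv_equiv :=
  EquivRel term_eqv term_eqv_refl term_eqv_sym term_eqv_trans.

Definition freelat : Type := {eq_quot term_eqv}.

HB.instance Definition _ := Choice.on freelat.
HB.instance Definition _ := EqQuotient.on freelat.

Implicit Types a b c : freelat.

Lemma eval_repr (d : Order.disp_t) (L : latticeType d) (g : X -> L) t :
  eval g (repr (\pi_freelat t)) = eval g t.
Proof.
have /eqquotP/andP[/asboolP le_rt /asboolP le_tr] :
  repr (\pi_freelat t) = t %[mod freelat] by rewrite reprK.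
by apply: le_anti; rewrite le_rt le_tr.
Qed.

Definition freelat_le a b := term_le (repr a) (repr b).
Definition freelat_meet a b := \pi_freelat (Meet (repr a) (repr b)).
Definition freelat_join a b := \pi_freelat (Join (repr a) (repr b)).

Fact freelat_le_refl : reflexive freelat_le.
Proof. by move=> a; apply: term_le_refl. Qed.

Fact freelat_le_anti : antisymmetric freelat_le.
Proof. by move=> a b ab; rewrite -[a]reprK -[b]reprK; apply/eqquotP. Qed.

Fact freelat_le_trans : transitive freelat_le.
Proof. by move=> b a c; apply: term_le_trans. Qed.

Fact freelat_display : Order.disp_t. Proof. exact: Order.Disp tt tt. Qed.

HB.instance Definition _ := Order.Le_isPOrder.Build freelat_display freelat
  freelat_le_refl freelat_le_anti freelat_le_trans.

Fact freelat_meetP a b c : (a <= freelat_meet b c) = (a <= b) && (a <= c).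
Proof.
apply/asboolP/andP => [abc | [/asboolP ab /asboolP ac] d L g].
  by split; apply/asboolP => d L g; have := abc d L g;
    rewrite eval_repr lexI => /andP[].
by rewrite eval_repr lexI ab ac.
Qed.

Fact freelat_joinP a b c : (freelat_join a b <= c) = (a <= c) && (b <= c).
Proof.
apply/asboolP/andP => [abc | [/asboolP ac /asboolP bc] d L g].
  by split; apply/asboolP => d L g; have := abc d L g;
    rewrite eval_repr leUx => /andP[].
by rewrite eval_repr leUx ac bc.
Qed.

HB.instance Definition _ :=
  Order.POrder_MeetJoin_isLattice.Build freelat_display freelat
    freelat_meetP freelat_joinP.

Definition free_var (x : X) : freelat := \pi_freelat (Var x).

Lemma pi_eval t : \pi_freelat t = eval free_var t.
Proof.
elim: t => //= s <- t <-; apply/eqquotP/andP; split; apply/asboolP => d L g;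
  by rewrite /= !eval_repr.
Qed.

Lemma generates_free_var : generates free_var.
Proof.
move=> P Pvar PI PU a; rewrite -[a]reprK pi_eval.
by elim: (repr a) => //= s Ps t Pt; [apply: PI | apply: PU].
Qed.

Section Lift.
Variables (d : Order.disp_t) (L : latticeType d) (g : X -> L).

Definition free_eval a : L := eval g (repr a).

Fact free_evalI : {morph free_eval : a b / a `&` b}.
Proof. by move=> a b; apply: eval_repr. Qed.

Fact free_evalU : {morph free_eval : a b / a `|` b}.
Proof. by move=> a b; apply: eval_repr. Qed.

Definition free_lift : {lmorphism freelat -> L} :=
  lmorphism_of free_evalI free_evalU.

Lemma free_lift_var x : free_lift (free_var x) = g x.
Proof. exact: eval_repr. Qed.

End Lift.

Lemma free_lattice_free_var : free_lattice free_var.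
Proof.
move=> d L g; exists (free_lift g); split=> [|h hg]; first exact: free_lift_var.
by apply: (eq_lmorphism generates_free_var) => x; rewrite hg [RHS]free_lift_var.
Qed.

End FreeLattice.

Section FreeLatticeTheory.
Variables (X : Type) (d : Order.disp_t) (F : latticeType d) (i : X -> F).
Hypothesis free_i : free_lattice i.

Lemma free_endo_id (h : {lmorphism F -> F}) : h \o i =1 i -> h =1 id.
Proof.
have [h0 [_ h0_uniq]] := free_i i => hi y.
by rewrite h0_uniq // -(h0_uniq (idfun : {lmorphism F -> F})).
Qed.

Lemma free_lattice_generates : generates i.
Proof.
have [h [hi _]] := free_i (@free_var X).
have khK : free_lift i \o h =1 id.
  apply: (free_endo_id (h := free_lift i \o h)) => x.
  by rewrite -[RHS]free_lift_var -(hi x).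
move=> P Pi PI PU y.
suff Plift a : P (free_lift i a) by rewrite -[y]khK; apply: Plift.
elim/generates_free_var: a => [x | a b Pa Pb | a b Pa Pb].
- by rewrite free_lift_var.
- by rewrite omorphI; apply: PI.
- by rewrite omorphU; apply: PU.
Qed.

Lemma free_lattice_dual : free_lattice (i : X -> F^d).
Proof.
move=> d' L g; have [h [hi h_uniq]] := free_i (g : X -> L^d).
exists (lmorphism_of (f := h : F^d -> L) (omorphU h) (omorphI h)); split=> // k.
exact: h_uniq (lmorphism_of (f := k : F -> L^d) (omorphU k) (omorphI k)).
Qed.

End FreeLatticeTheory.

(** * Whitman's condition and semidistributivity *)

Definition whitman (d : Order.disp_t) (L : latticeType d) : Prop :=
  forall a b p q : L, a `&` b <= p `|` q ->
  [\/ a <= p `|` q, b <= p `|` q, a `&` b <= p | a `&` b <= q].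

Definition join_prime (d : Order.disp_t) (L : latticeType d) (x : L) : Prop :=
  forall a b : L, x <= a `|` b -> x <= a \/ x <= b.

(* Day's doubling of the interval [v, u]: the elements of the interval occur
   with both labels, the other elements above v only with label true, and the
   remaining ones only with label false. *)
Section Doubling.
Variables (d : Order.disp_t) (F : latticeType d) (v u : F).

Definition in_doubling (p : F *p bool) : bool :=
  if p.2 then v <= p.1 else (v <= p.1) ==> (p.1 <= u).

Definition doubling : Type := {p : F *p bool | in_doubling p}.

HB.instance Definition _ := SubChoice.on doubling.
HB.instance Definition _ := [SubChoice_isSubPOrder of doubling by <: with d].

Implicit Types a b c : doubling.

Fact doubling_meet_subproof a b : in_doubling (val a `&` val b).
Proof.
case: a b => [[x [|]] xP] [[y [|]] yP]; rewrite /in_doubling /= lexI in xP yP *.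
- by rewrite xP yP.
- by apply/implyP => /andP[_ /(implyP yP)]; apply/le_trans/leIr.
- by apply/implyP => /andP[/(implyP xP) + _]; apply/le_trans/leIl.
- by apply/implyP => /andP[/(implyP xP) + _]; apply/le_trans/leIl.
Qed.

Definition forced_label (x : F) : bool := (v <= x) && ~~ (x <= u).

Definition doubling_join_pair a b : F *p bool :=
  let x := (val a).1 `|` (val b).1 in
  (x, [|| (val a).2, (val b).2 | forced_label x]).

Fact doubling_join_subproof a b : in_doubling (doubling_join_pair a b).
Proof.
rewrite /doubling_join_pair /forced_label /in_doubling /=.
case: a b => [[x [|]] xP] [[y [|]] yP] //=; rewrite /in_doubling /= in xP yP.
- exact: le_trans xP (leUl _ _).
- exact: le_trans xP (leUl _ _).
- exact: le_trans yP (leUr _ _).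
- by case: (v <= _); case: (_ <= u).
Qed.

Definition doubling_meet a b : doubling := Sub _ (doubling_meet_subproof a b).
Definition doubling_join a b : doubling := Sub _ (doubling_join_subproof a b).

Fact doubling_meetP a b c : (a <= doubling_meet b c) = (a <= b) && (a <= c).
Proof. by rewrite !leEsub /= lexI. Qed.

Fact doubling_joinP a b c : (doubling_join a b <= c) = (a <= c) && (b <= c).
Proof.
rewrite !leEsub !leEprod /= leUx.
have [ac | _] //= := boolP ((val a).1 <= _).
have [bc | _] /= := boolP ((val b).1 <= _); last by rewrite andbF.
have : forced_label ((val a).1 `|` (val b).1) ==> (val c).2.
  apply/implyP => /andP[vab]; apply: contraNT => c2.
  have abc : (val a).1 `|` (val b).1 <= (val c).1 by rewrite leUx ac bc.
  have := valP c; rewrite /in_doubling (negPf c2) (le_trans vab abc) /=.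
  exact: le_trans abc.
by case: (forced_label _); case: (val a).2; case: (val b).2; case: (val c).2.
Qed.

HB.instance Definition _ := Order.POrder_MeetJoin_isLattice.Build d doubling
  doubling_meetP doubling_joinP.

Definition doubling_fst : {lmorphism doubling -> F} :=
  lmorphism_of (f := fun a => (val a).1) (fun _ _ => erefl) (fun _ _ => erefl).

End Doubling.

Section FreeWhitman.
Variables (X : Type) (d : Order.disp_t) (F : latticeType d) (i : X -> F).
Hypothesis free_i : free_lattice i.

Lemma free_doubling_section (v u : F) :
  exists h : {lmorphism F -> doubling v u},
    (forall y, (val (h y)).1 = y) /\ (forall x, (val (h (i x))).2 = (v <= i x)).
Proof.
have lift_subproof x : in_doubling v u (i x, v <= i x).
  by rewrite /in_doubling /=; case: (v <= i x).
pose lift x : doubling v u := Sub (i x, v <= i x) (lift_subproof x).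
have [h [hi _]] := free_i lift.
exists h; split=> [y | x]; last by rewrite [h _]hi.
apply: (free_endo_id free_i (h := doubling_fst v u \o h)) => x.
by rewrite /= [h _]hi.
Qed.

(* [l] gives the labels in the doubling of [v, p `|` q]: those of [p] and [q]
   are false, hence so is that of [p `|` q], which is not forced to be true. *)
Lemma free_join_labels (v p q : F) :
    v <= p `|` q -> ~~ (v <= p) -> ~~ (v <= q) ->
  exists l : F -> bool,
    [/\ forall x, l (i x) = (v <= i x),
        forall y, v <= y -> ~~ (y <= p `|` q) -> l y,
        forall y z, l (y `&` z) = l y && l z
      & l v = false].
Proof.
move=> le_v vp vq; set u := p `|` q in le_v *.
have [h [h_fst h_gen]] := free_doubling_section v u.
have labelP y : in_doubling v u (y, (val (h y)).2).
  by rewrite -[y in (y, _)]h_fst -surjective_pairing; apply: valP.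
have below_false y : ~~ (v <= y) -> (val (h y)).2 = false.
  by move=> vy; apply: contraNF vy => hy; have := labelP y; rewrite hy.
exists (fun y => (val (h y)).2); split=> // [y vy yu | y z |].
- apply: contraNT yu => hy; have := labelP y.
  by rewrite /in_doubling (negPf hy) vy.
- by rewrite omorphI.
have : h v <= h u := omorph_le h le_v.
rewrite /u omorphU leEsub leEprod /= !h_fst.
rewrite (below_false p) // (below_false q) //.
by rewrite /forced_label lexx andbF => /andP[_]; case: (val _).2.
Qed.

Lemma free_whitman : whitman F.
Proof.
move=> a b p q le_ab.
have [|nab_p] := boolP (a `&` b <= p); first by constructor 3.
have [|nab_q] := boolP (a `&` b <= q); first by constructor 4.
have [l [_ l_above lI l_ab]] := free_join_labels le_ab nab_p nab_q.
have [|na] := boolP (a <= p `|` q); first by constructor 1.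
have [|nb] := boolP (b <= p `|` q); first by constructor 2.
by move: l_ab; rewrite lI !l_above ?leIl ?leIr.
Qed.

Lemma free_join_prime x : join_prime (i x).
Proof.
move=> a b le_x.
have [|nxa] := boolP (i x <= a); first by left.
have [|nxb] := boolP (i x <= b); first by right.
have [l [li _ _]] := free_join_labels le_x nxa nxb.
by rewrite li lexx.
Qed.

End FreeWhitman.

(* If [x `|` z = y `|` z], every element below this join is below
   [(x `&` y) `|` z], by induction on the generation of that element. *)
Lemma whitman_join_semidistributive (X : Type) (d : Order.disp_t)
    (L : latticeType d) (g : X -> L) :
    generates g -> whitman L -> (forall x, join_prime (g x)) ->
  join_semidistributive L.
Proof.
move=> gen_g W prime_g x y z xy; set w := (x `&` y) `|` z.
suff below t : t <= x `|` z -> t <= w.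
  by apply: le_anti; rewrite below // leU2 ?leIl.
have le_zw : z <= w := leUr _ _.
have of_summands r :
    (forall p, p `|` z = x `|` z -> r <= w \/ r <= p) -> r <= w.
  move=> rp; have [//|rx] := rp x erefl; have [//|ry] := rp y (esym xy).
  by apply: le_trans (leUl _ _); rewrite lexI rx ry.
elim/gen_g: t => [i | s t IHs IHt | s t IHs IHt] le_u.
- apply: of_summands => p pz; rewrite -pz in le_u.
  have [ip|iz] := prime_g i _ _ le_u; first by right.
  by left; apply: le_trans iz le_zw.
- apply: of_summands => p pz; move: (le_u); rewrite -{1}pz => /W[]; rewrite ?pz.
  + by move=> /IHs sw; left; apply: le_trans (leIl _ _) sw.
  + by move=> /IHt tw; left; apply: le_trans (leIr _ _) tw.
  + by right.
  + by move=> stz; left; apply: le_trans stz le_zw.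
- by move: le_u; rewrite !leUx => /andP[/IHs-> /IHt].
Qed.

Lemma free_join_semidistributive (X : Type) (d : Order.disp_t)
    (F : latticeType d) (i : X -> F) :
  free_lattice i -> join_semidistributive F.
Proof.
move=> free_i; apply: (whitman_join_semidistributive (g := i)).
- exact: free_lattice_generates.
- exact: free_whitman free_i.
- exact: free_join_prime free_i.
Qed.

Lemma free_semidistributive (X : Type) (d : Order.disp_t)
    (F : latticeType d) (i : X -> F) :
  free_lattice i -> semidistributive F.
Proof.
move=> free_i; split; first exact: free_join_semidistributive free_i.
exact: free_join_semidistributive (free_lattice_dual free_i).
Qed.

(** * Images of free lattices *)

Definition lower_adjoint_at (d d' : Order.disp_t) (F : porderType d)
    (L : porderType d') (f : F -> L) (y : L) (b : F) : Prop :=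
  forall t, (b <= t) = (y <= f t).

Section LowerAdjoint.
Variables (d d' : Order.disp_t) (F : latticeType d) (L : latticeType d').
Variable f : F -> L.
Hypothesis fI : {morph f : x y / x `&` y}.

Lemma lower_adjointU y z b c :
  lower_adjoint_at f y b -> lower_adjoint_at f z c ->
  lower_adjoint_at f (y `|` z) (b `|` c).
Proof. by move=> yb zc t; rewrite !leUx yb zc. Qed.

Lemma lower_adjoint_uniq y b c :
  lower_adjoint_at f y b -> lower_adjoint_at f y c -> b = c.
Proof. by move=> yb yc; apply: le_anti; rewrite yb -yc lexx yc -yb lexx. Qed.

Lemma least_lower_adjoint y b :
  is_least (fun t => f t = y) b -> lower_adjoint_at f y b.
Proof.
move=> [fb b_le] t; apply/idP/idP => [/(meet_morph_homo fI)|/meet_idPl yt].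
  by rewrite fb.
by apply: le_trans (b_le (b `&` t) _) (leIr _ _); rewrite fI fb.
Qed.

Lemma lower_adjoint_least y b : (exists t, f t = y) ->
  lower_adjoint_at f y b -> is_least (fun t => f t = y) b.
Proof.
move=> [t0 ft0] yb; split=> [|t ft]; last by rewrite yb ft.
apply: le_anti; rewrite -yb lexx andbT -[leRHS]ft0.
by apply: (meet_morph_homo fI); rewrite yb ft0.
Qed.

Lemma image_join_semidistributive :
    {morph f : x y / x `|` y} ->
    (forall y, exists b, is_least (fun t => f t = y) b) ->
  join_semidistributive F -> join_semidistributive L.
Proof.
move=> fU f_least sdF x y z xy.
have [a [fa /(conj fa)/least_lower_adjoint xa]] := f_least x.
have [b [fb /(conj fb)/least_lower_adjoint yb]] := f_least y.
have [c [fc /(conj fc)/least_lower_adjoint zc]] := f_least z.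
have ab : a `|` c = b `|` c.
  apply: lower_adjoint_uniq (lower_adjointU xa zc) _.
  by rewrite xy; apply: lower_adjointU.
by rewrite -fa -fb -fc -fI -!fU -sdF.
Qed.

End LowerAdjoint.

Lemma bounded_image_semidistributive (d : Order.disp_t) (L : latticeType d) :
  bounded_image_of_free L -> semidistributive L.
Proof.
move=> [X [d' [F [i [/free_semidistributive[sdj sdm] [f [_ fib]]]]]]]; split.
  apply: image_join_semidistributive (omorphI f) (omorphU f) _ sdj => y.
  by case: (fib y).
apply: (image_join_semidistributive (f := f : F^d -> L^d) (omorphU f)
  (omorphI f) _ sdm).
by move=> y; case: (fib y).
Qed.

Lemma meet_semidistributive_pseudocomplemented (d : Order.disp_t)
    (L : finTBLatticeType d) : meet_semidistributive L -> pseudocomplemented L.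
Proof.
move=> sdm x; exists (\join_(y | x `&` y == \bot) y); split.
  elim/big_ind: _ => [|y z xy xz|y /eqP //]; first exact: meetx0.
  by rewrite meetC -sdm ?[_ `&` x]meetC ?xy ?xz.
by move=> y /eqP xy; apply: joins_sup.
Qed.

Lemma pseudocomplemented_le_join (d : Order.disp_t) (L : bLatticeType d)
    (x y z : L) : pseudocomplemented L ->
  x `&` y = \bot -> x `&` z = \bot -> x <= y `|` z -> x = \bot.
Proof.
move=> pc xy xz x_yz; have [m [xm m_max]] := pc x.
by rewrite -xm; apply/esym/meet_idPl/(le_trans x_yz); rewrite leUx !m_max.
Qed.

(** * Lower bounded lattices *)

Definition ranked_join_generators (d : Order.disp_t) (L : finTBLatticeType d)
    (I : finType) (j : I -> L) (rank : I -> nat) : Prop :=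
  (forall y, y <= \join_(p | j p <= y) j p) /\
  (forall p y z, j p <= y `|` z -> ~~ (j p <= y) -> ~~ (j p <= z) ->
     j p <= \join_(q | (rank q < rank p)%N && ((j q <= y) || (j q <= z))) j q).

Section LowerBounded.
Variables (d d' : Order.disp_t) (F : latticeType d) (L : finTBLatticeType d').
Variables (X : finType) (g : X -> F) (f : F -> L).
Hypotheses (gen_g : generates g) (f_surj : forall y, exists t, f t = y).
Hypotheses (fI : {morph f : x y / x `&` y}) (fU : {morph f : x y / x `|` y}).

Definition has_lower_adjoint (y : L) : Prop := exists b, lower_adjoint_at f y b.

Lemma finite_lower_bound (I : finType) (P : pred I) (t : I -> F) (y : L) :
    (forall k, P k -> y <= f (t k)) ->
  exists2 b, y <= f b & forall k, P k -> b <= t k.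
Proof.
move=> yt; suff [b yb b_le] : exists2 b, y <= f b &
    forall k, k \in enum I -> P k -> b <= t k.
  by exists b => // k; apply: b_le; rewrite mem_enum.
elim: (enum I) => [|k s [b yb b_le]].
  by have [b fb] := f_surj y; exists b; rewrite ?fb.
have [Pk|nPk] := boolP (P k).
  exists (t k `&` b) => [|k']; first by rewrite fI lexI yt.
  case/predU1P=> [-> _|/b_le b_k' /b_k']; first exact: leIl.
  exact/le_trans/leIr.
by exists b => // k' /predU1P[->|/b_le //]; rewrite (negPf nPk).
Qed.

(* The adjoint value is the meet of the generators and the known adjoint values
   that map above [v]: by induction on the generation of [t], this meet is below
   every [t] that maps above [v]. *)
Lemma has_lower_adjoint_of_covers (v : L) :
    (forall y z, v <= y `|` z -> ~~ (v <= y) -> ~~ (v <= z) ->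
       exists2 w, v <= w <= y `|` z & has_lower_adjoint w) ->
  has_lower_adjoint v.
Proof.
move=> cover.
have /fin_all_exists[beta betaP] w :
    exists b, has_lower_adjoint w -> lower_adjoint_at f w b.
  have [[b wb]|no_adj] := pselect (has_lower_adjoint w); first by exists b.
  by have [b _] := f_surj w; exists b.
have [//|mX v_mX mX_le] := @finite_lower_bound _ (fun x => v <= f (g x)) g v.
have [|mL v_mL mL_le] := @finite_lower_bound L
    (fun w => `[< has_lower_adjoint w >] && (v <= w)) beta v.
  by move=> w /andP[/asboolP/betaP wb vw]; rewrite (le_trans vw) // -wb.
exists (mX `&` mL) => t; apply/idP/idP => [/(meet_morph_homo fI)|].
  by apply: le_trans; rewrite fI lexI v_mX.
elim/gen_g: t => [x | s t IHs IHt | s t IHs IHt].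
- by move=> /mX_le; apply/le_trans/leIl.
- by rewrite fI !lexI => /andP[/IHs-> /IHt].
rewrite fU => vst.
have [/IHs s_ge|vs] := boolP (v <= f s); first exact: le_trans s_ge (leUl _ _).
have [/IHt t_ge|vt] := boolP (v <= f t); first exact: le_trans t_ge (leUr _ _).
have [w /andP[vw wst] adj_w] := cover _ _ vst vs vt.
apply: le_trans (leIr _ _) (le_trans (mL_le w _) _).
  by rewrite vw andbT; apply/asboolP.
by rewrite betaP // fU.
Qed.

Lemma has_lower_adjoint_joins (I : finType) (P : pred I) (j : I -> L) :
  (forall p, P p -> has_lower_adjoint (j p)) ->
  has_lower_adjoint (\join_(p | P p) j p).
Proof.
move=> adj_j; elim/big_ind: _ => // [|y z [b yb] [c zc]].
  by apply: has_lower_adjoint_of_covers => y z _; rewrite le0x.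
by exists (b `|` c); apply: lower_adjointU.
Qed.

Lemma ranked_has_lower_adjoint (I : finType) (j : I -> L) (rank : I -> nat) :
  ranked_join_generators j rank -> forall y, has_lower_adjoint y.
Proof.
move=> [j_dense j_cover] y.
suff adj_j p : has_lower_adjoint (j p).
  have -> : y = \join_(p | j p <= y) j p.
    by apply: le_anti; rewrite j_dense; apply/joinsP.
  exact: has_lower_adjoint_joins.
have [n] := ubnP (rank p); elim: n p => // n IHn p lt_pn.
apply: has_lower_adjoint_of_covers => {}y z pyz py pz.
exists (\join_(q | (rank q < rank p)%N && ((j q <= y) || (j q <= z))) j q).
  rewrite j_cover //=; apply/joinsP => q /andP[_ /orP[qy|qz]].
    exact: le_trans qy (leUl _ _).
  exact: le_trans qz (leUr _ _).
apply: has_lower_adjoint_joins => q /andP[lt_qp _].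
exact/IHn/(leq_trans lt_qp).
Qed.

End LowerBounded.

Section DualAutomorphism.
Variables (d : Order.disp_t) (L : latticeType d) (compl : L -> L).
Hypothesis complK : involutive compl.
Hypothesis compl_le : {mono compl : x y /~ x <= y}.

Lemma dual_automorphismU x y : compl (x `|` y) = compl x `&` compl y.
Proof.
apply: le_anti; rewrite lexI !compl_le leUl leUr /=.
rewrite -[leLHS]complK compl_le leUx -{1}[x]complK -{2}[y]complK.
by rewrite !compl_le leIl leIr.
Qed.

Lemma dual_automorphismI x y : compl (x `&` y) = compl x `|` compl y.
Proof. by rewrite -[RHS]complK dual_automorphismU !complK. Qed.

End DualAutomorphism.

Lemma ranked_bounded_image (d : Order.disp_t) (L : finTBLatticeType d)
    (compl : L -> L) (I : finType) (j : I -> L) (rank : I -> nat) :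
    involutive compl -> {mono compl : x y /~ x <= y} ->
    ranked_join_generators j rank ->
  bounded_image_of_free L.
Proof.
move=> complK compl_le ranked; pose f := free_lift (@id L).
have f_surj y : exists t, f t = y by exists (free_var y); apply: free_lift_var.
exists L, _, _, (@free_var L); split; first exact: free_lattice_free_var.
exists f; split=> // y; split.
  have [b yb] := ranked_has_lower_adjoint (@generates_free_var L) f_surj
    (omorphI f) (omorphU f) ranked y.
  by exists b; apply: (lower_adjoint_least (omorphI f)).
pose f' : (freelat L)^d -> L := compl \o f.
have f'_surj z : exists t, f' t = z.
  by have [t ft] := f_surj (compl z); exists t; rewrite -[RHS]complK -ft.
have f'I : {morph f' : s t / s `&` t}.
  by move=> s t; rewrite -(dual_automorphismU complK) // -omorphU.
have f'U : {morph f' : s t / s `|` t}.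
  by move=> s t; rewrite -(dual_automorphismI complK) // -omorphI.
have gen_dual : generates (@free_var L : L -> (freelat L)^d).
  exact: free_lattice_generates (free_lattice_dual (@free_lattice_free_var L)).
have [b yb] :=
  ranked_has_lower_adjoint gen_dual f'_surj f'I f'U ranked (compl y).
exists b; apply: (lower_adjoint_least (f := f : _^d -> L^d) (omorphU f)) => //.
by move=> t; rewrite yb; apply: compl_le.
Qed.

(** * Open, closed and regular closed relations *)

Lemma mem_set_trans (E : finType) (G : {set E * E}) (y x z : E) :
  set_transitive G -> (x, y) \in G -> (y, z) \in G -> (x, z) \in G.
Proof. by move/set_transitiveP; apply. Qed.

Definition is_midpoint (E : finType) (G : {set E * E}) (x y z : E) : bool :=
  [&& z != x, z != y, (x, z) \in G & (z, y) \in G].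

Lemma is_midpointS (E : finType) (G G' : {set E * E}) (x y z : E) :
  G \subset G' -> is_midpoint G x y z -> is_midpoint G' x y z.
Proof.
move=> /subsetP GG' /and4P[zx zy xz zy_in].
by rewrite /is_midpoint zx zy !GG'.
Qed.

Lemma cl_midpoint (E : finType) (G : {set E * E}) (x y : E) : (x, y) \in cl G ->
  (x, y) \in G \/ exists z, is_midpoint (cl G) x y z.
Proof.
pose S := [set p in cl G |
  (p \in G) || [exists z, is_midpoint (cl G) p.1 p.2 z]].
suff /subsetP cl_S : cl G \subset S.
  by move=> /cl_S; rewrite inE => /andP[_ /orP[|/existsP]]; [left | right].
apply: cl_sub; last first.
  by apply/subsetP => p pG; rewrite inE pG (subsetP (sub_cl G)).
apply/set_transitiveP => v u w /=; rewrite ![_ \in S]inE.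
move=> /andP[uv uvS] /andP[vw vwS].
rewrite (mem_set_trans (cl_transitive G) uv vw) /=.
have [->|vu] := eqVneq u v; first exact: vwS.
have [<-|vw_neq] := eqVneq v w; first exact: uvS.
apply/orP; right; apply/existsP; exists v.
by rewrite /is_midpoint uv vw vw_neq eq_sym vu.
Qed.

Section Relations.
Variables (E : finType) (e : {set E * E}) (te : set_transitive e).
Implicit Types (a b x y z : E) (C S T U : {set E}) (G O : {set E * E}).
Implicit Types A B D Z : Reg te.

Let e_trans y x z : (x, y) \in e -> (y, z) \in e -> (x, z) \in e.
Proof. exact: mem_set_trans. Qed.

Lemma trile_refl x : trile e x x. Proof. by rewrite /trile /= eqxx orbT. Qed.

Lemma trileW x y : (x, y) \in e -> trile e x y.
Proof. by rewrite /trile /= => ->. Qed.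

Lemma trile_neq x y : trile e x y -> x != y -> (x, y) \in e.
Proof. by case/orP=> // /eqP ->; rewrite eqxx. Qed.

Lemma trile_in y x z : trile e x y -> (y, z) \in e -> (x, z) \in e.
Proof. by case/orP=> [xy yz|/eqP->//]; apply: e_trans xy yz. Qed.

Lemma in_trile y x z : (x, y) \in e -> trile e y z -> (x, z) \in e.
Proof. by move=> xy /orP[yz|/eqP<-//]; apply: e_trans xy yz. Qed.

Lemma trile_trans y x z : trile e x y -> trile e y z -> trile e x z.
Proof. by move=> xy /orP[yz|/eqP<-//]; apply/trileW/(trile_in xy yz). Qed.

Lemma open_split O y x z : is_open e O -> (x, z) \in O ->
  (x, y) \in e -> (y, z) \in e -> (x, y) \in O \/ (y, z) \in O.
Proof.
move=> /andP[_ /set_transitiveP tO] xzO xy yz; apply/orP.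
apply: contraLR xzO; rewrite negb_or => /andP[xyO yzO].
by have := tO y x z; rewrite /= !inE xyO yzO xy yz => /(_ isT isT) /andP[].
Qed.

Lemma open_split3 O a x y b : is_open e O -> (a, b) \in O ->
    trile e a x -> (x, y) \in e -> trile e y b ->
  [\/ (x, y) \in O, x != a /\ (a, x) \in O | y != b /\ (y, b) \in O].
Proof.
move=> opO abO ax xy yb.
have split_right u : (u, b) \in O -> (u, y) \in e ->
    (u, y) \in O \/ y != b /\ (y, b) \in O.
  move=> ubO uy; have [y_b|yb_neq] := eqVneq y b; first by left; rewrite y_b.
  have [|ybO] := open_split opO ubO uy (trile_neq yb yb_neq); first by left.
  by right.
have [xa|xa] := eqVneq x a.
  rewrite xa in xy *; have [ayO|ybO] := split_right a abO xy.
    by constructor 1.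
  by constructor 3.
have axe : (a, x) \in e by apply: trile_neq ax _; rewrite eq_sym.
have [axO|xbO] := open_split opO abO axe (in_trile xy yb).
  by constructor 2.
have [xyO|ybO] := split_right x xbO xy; first by constructor 1.
by constructor 3.
Qed.

Lemma open_setD G : set_transitive G -> G \subset e -> is_open e (e :\: G).
Proof.
by move=> tG Ge; rewrite /is_open subsetDl setDDr setDv set0U (setIidPr Ge).
Qed.

Lemma interiorE G : interior e G = e :\: cl (e :\: G).
Proof.
have /andP[int_e int_tr] := int_open G te.
apply/eqP; rewrite eqEsubset; apply/andP; split.
  rewrite subsetD int_e disjoint_sym.
  have : cl (e :\: G) \subset e :\: interior e G.
    by apply: cl_sub => //; apply/setDS/int_sub.
  by rewrite subsetD => /andP[].
apply: sub_int; first by rewrite open_setD ?cl_transitive // cl_sub ?subsetDl.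
by rewrite subDset setUC -subDset sub_cl.
Qed.

Lemma reg_transitive A : set_transitive (val A).
Proof. exact: regular_closed_trans (valP A). Qed.

Lemma reg_sub A : val A \subset e.
Proof. by case/andP: (valP A). Qed.

Lemma reg_cl_int A : val A = cl (interior e (val A)).
Proof. by case/andP: (valP A) => _ /eqP. Qed.

Lemma reg_leE A B : (A <= B) = (val A \subset val B). Proof. by []. Qed.

Lemma val_regU A B :
  val (A `|` B) = cl (interior e (val A) :|: interior e (val B)).
Proof.
apply/eqP; rewrite eqEsubset andbC clS ?setUSS ?int_sub //=.
apply: cl_sub; first exact: cl_transitive.
rewrite {1}(reg_cl_int A) {1}(reg_cl_int B) subUset.
by rewrite !clS ?subsetUl ?subsetUr.
Qed.

Definition reg_compl A : Reg te :=
  Sub (cl (interior e (e :\: val A))) (cl_int_regular (e :\: val A) te).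

Lemma val_reg_compl A : val (reg_compl A) = cl (e :\: val A).
Proof. by rewrite /= int_id // open_setD ?reg_transitive ?reg_sub. Qed.

Lemma reg_complK : involutive reg_compl.
Proof.
by move=> A; apply: val_inj; rewrite !val_reg_compl -interiorE -reg_cl_int.
Qed.

Lemma reg_compl_le : {mono reg_compl : A B /~ A <= B}.
Proof.
have anti A B : A <= B -> reg_compl B <= reg_compl A.
  by rewrite !reg_leE !val_reg_compl => AB; apply/clS/setDS.
by move=> A B; apply/idP/idP => /anti //; rewrite !reg_complK.
Qed.

Definition rect S T : {set E * E} := e :&: setX S T.

Lemma in_rect S T x y :
  ((x, y) \in rect S T) = [&& (x, y) \in e, x \in S & y \in T].
Proof. by rewrite in_setI in_setX. Qed.

Lemma rect_regular S T :
    (forall x y z, x \in S -> z \in T -> (x, y) \in e -> (y, z) \in e ->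
       (y \in S) || (y \in T)) ->
  regular_closed e (rect S T).
Proof.
move=> cover; have rect_open : is_open e (rect S T).
  rewrite /is_open subsetIl; apply/set_transitiveP => y x z /=.
  rewrite !in_setD !in_rect => /andP[xyN xy] /andP[yzN yz].
  rewrite xy yz (e_trans xy yz) /= !andbT in xyN yzN *.
  apply/negP => /andP[xS zT]; case/orP: (cover x y z xS zT xy yz) => [yS|yT].
    by rewrite yS zT in yzN.
  by rewrite xS yT in xyN.
rewrite /regular_closed subsetIl (int_id rect_open) cl_id //=.
apply/set_transitiveP => y x z /=; rewrite !in_rect.
by move=> /and3P[xy -> _] /and3P[yz _ ->]; rewrite (e_trans xy yz).
Qed.

(** * The clopen relations attached to pairs *)

(* Modifying [U] at [a] and [b] makes the sources and targets cover the interval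
   between [a] and [b], while [b] is no source and [a] no target if [a != b]. *)
Definition clopen a b U : {set E * E} :=
  rect ([set x | trile e a x] :&: (a |: (~: U :\ b)))
       ([set y | trile e y b] :&: (b |: (U :\ a))).

Lemma in_clopen a b U x y : ((x, y) \in clopen a b U) =
  [&& (x, y) \in e, trile e a x && ((x == a) || (x != b) && (x \notin U))
    & trile e y b && ((y == b) || (y != a) && (y \in U))].
Proof. by rewrite in_rect !inE. Qed.

Lemma clopen_regular a b U : regular_closed e (clopen a b U).
Proof.
apply: rect_regular => x y z; rewrite !inE => /andP[ax _] /andP[zb _] xy yz.
rewrite (trile_trans ax (trileW xy)) (trile_trans (trileW yz) zb) /=.
by case: (y == a); case: (y == b); case: (y \in U).
Qed.

Definition reg_clopen (p : E * E * {set E}) : Reg te :=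
  Sub (clopen p.1.1 p.1.2 p.2) (clopen_regular _ _ _).

Lemma mem_clopen a b U : (a, b) \in e -> (a, b) \in clopen a b U.
Proof. by move=> ab; rewrite in_clopen ab !trile_refl !eqxx. Qed.

Lemma open_clopen O a b : is_open e O -> (a, b) \in O ->
  clopen a b [set z | (a, z) \in O] \subset O.
Proof.
move=> opO abO; apply/subsetP => -[x y]; rewrite in_clopen !inE.
move=> /and3P[xy /andP[ax xO] /andP[_ yO]].
have ayO : (a, y) \in O by case/orP: yO => [/eqP->|/andP[]].
case/orP: xO => [/eqP->//|/andP[_ axO]].
have [xa|xa] := eqVneq a x; first by rewrite -xa.
by case: (open_split opO ayO (trile_neq ax xa) xy) => // h; rewrite h in axO.
Qed.

Lemma interior_clopen A x y : (x, y) \in interior e (val A) ->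
  exists2 U, reg_clopen (x, y, U) <= A & (x, y) \in clopen x y U.
Proof.
move=> xyA; have opA := int_open (val A) te.
have /andP[/subsetP int_e _] := opA.
exists [set z | (x, z) \in interior e (val A)]; last by apply/mem_clopen/int_e.
exact: subset_trans (open_clopen opA xyA) (int_sub _ _).
Qed.

Lemma reg_clopen_dense A : A <= \join_(p | reg_clopen p <= A) reg_clopen p.
Proof.
set Z := \join_(_ | _) _; rewrite reg_leE {1}reg_cl_int.
apply: cl_sub; first exact: reg_transitive.
apply/subsetP => -[x y] /interior_clopen[U UA xyU].
have /subsetP UZ : reg_clopen (x, y, U) <= Z by apply: joins_sup.
exact: UZ.
Qed.

Lemma interior_midpoint a b U D G :
    val D \subset G -> clopen a b U \subset G ->
    ~~ (clopen a b U \subset val D) -> (a, b) \in interior e (val D) ->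
  exists c, is_midpoint G a b c.
Proof.
move=> /subsetP DG /subsetP UG /subsetPn[[x y]]; rewrite in_clopen.
move=> /and3P[xy /andP[ax xU] /andP[yb yU]] xyD abD.
have int_D p : p \in interior e (val D) -> p \in val D.
  exact: subsetP (int_sub _ _) p.
have [/int_D xyD'|[xa /int_D axD]|[y_b /int_D ybD]] :=
    open_split3 (int_open _ te) abD ax xy yb.
- by rewrite xyD' in xyD.
- rewrite (negPf xa) /= in xU; have /andP[xb _] := xU.
  exists x; rewrite /is_midpoint xa xb DG // UG //.
  by rewrite in_clopen (in_trile xy yb) ax xU trile_refl eqxx orbT.
- rewrite (negPf y_b) /= in yU; have /andP[ya _] := yU.
  exists y; rewrite /is_midpoint ya y_b (DG _ ybD) UG //.
  by rewrite in_clopen (trile_in ax xy) yb yU trile_refl eqxx orbT.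
Qed.

Lemma clopen_midpoint a b U A B : reg_clopen (a, b, U) <= A `|` B ->
    ~~ (reg_clopen (a, b, U) <= A) -> ~~ (reg_clopen (a, b, U) <= B) ->
  exists c, is_midpoint (val (A `|` B)) a b c.
Proof.
move=> UAB nA nB; have ab : (a, b) \in e.
  case/subsetPn: nA => -[x y]; rewrite in_clopen => + _.
  move=> /and3P[xy /andP[ax _] /andP[yb _]].
  exact: trile_in ax (in_trile xy yb).
have := subsetP UAB _ (mem_clopen U ab); rewrite {1}val_regU.
case/cl_midpoint => [/setUP[] abD|]; last by rewrite -val_regU.
  by apply: (interior_midpoint _ UAB nA abD); rewrite -reg_leE leUl.
by apply: (interior_midpoint _ UAB nB abD); rewrite -reg_leE leUr.
Qed.

(** * Lower boundedness of the lattice of regular closed relations *)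

Definition decreasing_on_factors (r : E -> E -> nat) : Prop :=
  forall x y z, is_midpoint e x y z -> (r x z < r x y)%N /\ (r z y < r x y)%N.

Section Ranked.
Variable r : E -> E -> nat.
Hypothesis r_decr : decreasing_on_factors r.

Definition index_rank (p : E * E * {set E}) : nat := r p.1.1 p.1.2.

Lemma mem_join_rank_lt A B Z n x y :
    (forall q, (index_rank q < n)%N ->
       (reg_clopen q <= A) || (reg_clopen q <= B) -> reg_clopen q <= Z) ->
  (x, y) \in val (A `|` B) -> (r x y < n)%N -> (x, y) \in val Z.
Proof.
elim: n x y => // n IHn x y small; rewrite val_regU.
move=> /cl_midpoint[xyAB lt_n|[z]].
  have [U UAB xyU] : exists2 U,
      (reg_clopen (x, y, U) <= A) || (reg_clopen (x, y, U) <= B)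
      & (x, y) \in clopen x y U.
    by case/setUP: xyAB => /interior_clopen[U UD xyU];
      exists U; rewrite // UD ?orbT.
  exact: subsetP (small (x, y, U) lt_n UAB) _ xyU.
rewrite -val_regU ltnS => mid le_n; have /and4P[_ _ xz zy] := mid.
have [lt_xz lt_zy] := r_decr (is_midpointS (reg_sub _) mid).
have {}IHn u v : (u, v) \in val (A `|` B) -> (r u v < r x y)%N ->
    (u, v) \in val Z.
  move=> uv lt_xy; apply: IHn => // [q lt_q|]; last exact: leq_trans lt_xy le_n.
  exact/small/ltnW.
exact: mem_set_trans (reg_transitive Z) (IHn _ _ xz lt_xz) (IHn _ _ zy lt_zy).
Qed.

Lemma clopen_rank_lt a b U x y : (x, y) \in clopen a b U -> (x, y) != (a, b) ->
  (r x y < r a b)%N.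
Proof.
rewrite in_clopen xpair_eqE => /and3P[xy /andP[ax xU] /andP[yb yU]].
have r_tgt : y != b -> y != a /\ (r a y < r a b)%N.
  move=> y_b; rewrite (negPf y_b) /= in yU; have /andP[ya _] := yU.
  have [|lt_ay _] // := r_decr (x := a) (y := b) (z := y).
  by rewrite /is_midpoint ya y_b (trile_in ax xy) trile_neq.
have [-> /= /r_tgt[]//|xa _] := eqVneq x a.
rewrite (negPf xa) /= in xU; have /andP[xb nxU] := xU.
have axe : (a, x) \in e by apply: trile_neq ax _; rewrite eq_sym.
have r_src : x != y -> (r x y < r a y)%N.
  move=> x_y; have [|_ lt_xy] // := r_decr (x := a) (y := y) (z := x).
  by rewrite /is_midpoint xa x_y axe.
have [y_b|y_b] := eqVneq y b; first by rewrite y_b in r_src *; apply: r_src.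
have [_ lt_ay] := r_tgt y_b; apply: ltn_trans (r_src _) lt_ay.
by apply: contraNneq nxU => ->; move: yU; rewrite (negPf y_b) => /andP[].
Qed.

Lemma reg_clopen_ranked : ranked_join_generators reg_clopen index_rank.
Proof.
split=> [|[[a b] U] A B UAB nA nB]; first exact: reg_clopen_dense.
set Z := \join_(_ | _) _; apply/subsetP => -[x y] xyU.
have rank_lt u v :
    (u, v) \in val (A `|` B) -> (r u v < r a b)%N -> (u, v) \in val Z.
  by apply: mem_join_rank_lt => q lt_q qAB; apply: joins_sup; rewrite lt_q.
have [[-> ->]|xy_ab] := eqVneq (x, y) (a, b); last first.
  exact: rank_lt (subsetP UAB _ xyU) (clopen_rank_lt xyU xy_ab).
have [c mid] := clopen_midpoint UAB nA nB; have /and4P[_ _ ac cb] := mid.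
have [lt_ac lt_cb] := r_decr (is_midpointS (reg_sub _) mid).
apply: mem_set_trans (reg_transitive Z) (rank_lt _ _ ac lt_ac) _.
exact: rank_lt cb lt_cb.
Qed.

Lemma decreasing_bounded_image : bounded_image_of_free (Reg te).
Proof.
exact: ranked_bounded_image reg_complK reg_compl_le reg_clopen_ranked.
Qed.

End Ranked.

(** * Pseudocomplements and components *)

Definition cut S : {set E * E} := rect S (~: S).

Lemma in_cut S x y :
  ((x, y) \in cut S) = [&& (x, y) \in e, x \in S & y \notin S].
Proof. by rewrite in_rect inE. Qed.

Lemma cut_regular S : regular_closed e (cut S).
Proof. by apply: rect_regular => x y z _ _ _ _; rewrite inE orbN. Qed.

Definition reg_cut S : Reg te := Sub (cut S) (cut_regular S).

Lemma reg_cutU S T : reg_cut (S :|: T) <= reg_cut S `|` reg_cut T.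
Proof.
apply: subset_trans (sub_cl _); apply/subsetP => -[x y].
rewrite in_setU !in_cut !inE negb_or => /and3P[-> /orP[->|->] /andP[-> ->]] //.
by rewrite orbT.
Qed.

Lemma reg_cutI S T : reg_cut (S :&: T) <= reg_cut S `|` reg_cut T.
Proof.
apply: subset_trans (sub_cl _); apply/subsetP => -[x y].
rewrite in_setU !in_cut !inE negb_and => /and3P[-> /andP[-> ->] /orP[->|->]] //.
by rewrite orbT.
Qed.

Lemma reg_cut_meet_eq0 S T :
    (forall x y, (x, y) \in cut S -> (x, y) \in cut T ->
       exists z, [/\ (x, z) \in e, (z, y) \in e & (z \in S) != (z \in T)]) ->
  reg_cut S `&` reg_cut T = \bot.
Proof.
move=> between; pose O := interior e (cut S :&: cut T).
have opO : is_open e O := int_open _ te.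
suff O0 : O = set0.
  apply: val_inj; rewrite /= -/O O0 cl_id //.
  exact: regular_closed_trans (regular0 te).
have inO p : p \in O -> p \in cut S /\ p \in cut T.
  by move=> /(subsetP (int_sub _ _)) /setIP.
apply/setP => -[x y]; rewrite inE; apply/negP => xyO.
have [xyS xyT] := inO _ xyO; have [z [xz zy]] := between x y xyS xyT.
case: (open_split opO xyO xz zy) => /inO[]; rewrite !in_cut.
  by move=> /and3P[_ _ /negPf->] /and3P[_ _ /negPf->].
by move=> /and3P[_ -> _] /and3P[_ -> _].
Qed.

Definition isolated_equivalents : Prop :=
  forall x y z, x != y -> (x, y) \in e -> (y, x) \in e -> z != x -> z != y ->
  (x, z) \notin e /\ (z, x) \notin e.

Lemma reg_cut_pair_meet_eq0 x y : x != y -> (x, y) \in e -> (y, x) \in e ->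
  reg_cut [set x; y] `&` reg_cut [set x] = \bot.
Proof.
move=> xy xye yxe; apply: reg_cut_meet_eq0 => u v; rewrite !in_cut !inE.
move=> _ /and3P[uv /eqP u_x _]; rewrite u_x in uv *.
exists y; split; [exact: xye | exact: e_trans yxe uv |].
by rewrite !inE eqxx orbT [y == x]eq_sym (negPf xy).
Qed.

Lemma reg_cutC_pair_meet_eq0 x y : x != y -> (x, y) \in e -> (y, x) \in e ->
  reg_cut (~: [set x; y]) `&` reg_cut (~: [set x]) = \bot.
Proof.
move=> xy xye yxe; apply: reg_cut_meet_eq0 => u v; rewrite !in_cut !inE !negbK.
move=> _ /and3P[uv _ /eqP v_x]; rewrite v_x in uv *.
exists y; split; [exact: e_trans uv xye | exact: yxe |].
by rewrite !inE eqxx orbT [y == x]eq_sym (negPf xy).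
Qed.

Lemma pseudocomplemented_isolated :
  pseudocomplemented (Reg te) -> isolated_equivalents.
Proof.
move=> pc x y z xy xye yxe zx zy; have yx : y != x by rewrite eq_sym.
have cut0 : reg_cut [set x; y] = \bot.
  apply: (pseudocomplemented_le_join pc _ _ (reg_cutU [set x] [set y])).
    exact: reg_cut_pair_meet_eq0.
  by rewrite setUC reg_cut_pair_meet_eq0.
have cutC0 : reg_cut (~: [set x; y]) = \bot.
  have cutC_le := reg_cutI (~: [set x]) (~: [set y]); rewrite -setCU in cutC_le.
  apply: (pseudocomplemented_le_join pc _ _ cutC_le).
    exact: reg_cutC_pair_meet_eq0.
  by rewrite setUC reg_cutC_pair_meet_eq0.
split.
- apply/negP => xze; have : (x, z) \in val (reg_cut [set x; y]).
    by rewrite in_cut xze !inE eqxx negb_or zx zy.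
  by rewrite cut0 inE.
- apply/negP => zxe; have : (z, x) \in val (reg_cut (~: [set x; y])).
    by rewrite in_cut zxe !inE eqxx negb_or zx zy.
  by rewrite cutC0 inE.
Qed.

Definition antisymmetric_or_pair C : Prop :=
  set_antisymmetric (restriction e C) \/
  exists a b, [/\ C = [set a; b], a <> b, (a, b) \in e & (b, a) \in e].

Definition linked : rel E := [rel x y | trile e x y || trile e y x].

Lemma linked_connect_sym : connect_sym linked.
Proof. by apply: sym_connect_sym => x y; rewrite /linked /= orbC. Qed.

Lemma mem_component x y : (y \in component e x) = connect linked x y.
Proof. by rewrite inE. Qed.

Lemma component_eq x y : y \in component e x -> component e y = component e x.
Proof.
rewrite mem_component => xy; apply/setP => z.
by rewrite !mem_component (same_connect linked_connect_sym xy).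
Qed.

Lemma linked_component x y : linked x y -> y \in component e x.
Proof. by rewrite mem_component; apply: connect1. Qed.

Lemma isolated_component_pair x y : isolated_equivalents ->
  x != y -> (x, y) \in e -> (y, x) \in e -> component e x = [set x; y].
Proof.
move=> isol xy xye yxe.
have linked_pair s t u : s != t -> (s, t) \in e -> (t, s) \in e ->
    linked s u -> u \in [set s; t].
  move=> st ste tse; rewrite !inE; have [//|us] := eqVneq u s.
  have [//|ut] := eqVneq u t; have [nsu nus] := isol s t u st ste tse us ut.
  case/orP=> [/trile_neq su|/trile_neq us_e]; last by rewrite us_e in nus.
  by rewrite su // eq_sym in nsu.
have pair_closed : closed linked [set x; y].
  apply: (intro_closed linked_connect_sym) => u v uv /set2P[] u_eq;
    rewrite u_eq in uv; first exact: linked_pair uv.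
  by rewrite setUC; apply: linked_pair uv; rewrite // eq_sym.
apply/setP => z; apply/idP/idP => [|/set2P[]->].
- rewrite mem_component => /(closed_connect pair_closed) <-.
  by rewrite !inE eqxx.
- by rewrite mem_component.
- by apply: linked_component; rewrite /linked /= trileW.
Qed.

Lemma isolated_component C : isolated_equivalents -> C \in components e ->
  antisymmetric_or_pair C.
Proof.
move=> isol /imsetP[x0 _ ->]; set C0 := component e x0.
have [anti|] := pselect (set_antisymmetric (restriction e C0)); first by left.
move=> /existsNP[x /existsNP[y]].
move=> /not_implyP[+ /not_implyP[+ /eqP xy]].
rewrite !in_setI !in_setX /= => /and3P[xye xC _] /andP[yxe _].
right; exists x, y; split=> //; last exact/eqP.
by rewrite /C0 -(component_eq xC); apply: isolated_component_pair.
Qed.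

Lemma component_isolated :
  (forall C, C \in components e -> antisymmetric_or_pair C) ->
  isolated_equivalents.
Proof.
move=> comp x y z xy xye yxe zx zy.
have xC : x \in component e x by rewrite mem_component.
have yC : y \in component e x.
  by apply: linked_component; rewrite /linked /= trileW.
suff zC : z \notin component e x.
  split; apply: contra zC => xz; apply: linked_component;
  by rewrite /linked /= (trileW xz) ?orbT.
apply/negP => zC.
case: (comp (component e x) (imset_f _ _)) => // [anti|[a [b [C_eq _ _ _]]]].
  by case/eqP: xy; apply: anti; rewrite in_setI in_setX /= xC yC ?xye ?yxe.
move: xC yC zC xy zx zy; rewrite C_eq.
by do 3![case/set2P => ->]; rewrite ?eqxx.
Qed.

Definition interval x y : {set E} := [set z | trile e x z && trile e z y].

(* The summand [x == y] ranks the loop [(x, x)] above [(x, y)] when [x] and [y]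
   are equivalent, hence have the same intervals. *)
Definition interval_rank x y : nat := #|interval x y| + (x == y).

Lemma interval_rank_decreasing : isolated_equivalents ->
  decreasing_on_factors interval_rank.
Proof.
move=> isol x y z /and4P[zx zy xz z_y].
have [x_z y_z] : x != z /\ y != z by rewrite ![_ == z]eq_sym.
have sub_l : interval x z \subset interval x y.
  apply/subsetP => u; rewrite !inE => /andP[-> uz].
  exact: trile_trans uz (trileW z_y).
have sub_r : interval z y \subset interval x y.
  apply/subsetP => u; rewrite !inE => /andP[zu ->].
  by rewrite (trile_trans (trileW xz) zu).
rewrite /interval_rank (negPf x_z) (negPf zy) !addn0.
have [_|x_y] := eqVneq x y; first by rewrite addn1 !ltnS !subset_leq_card.
have y_x : y != x by rewrite eq_sym.
have xy := e_trans xz z_y; rewrite addn0.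
split; apply: proper_card; rewrite properE ?sub_l ?sub_r; apply/subsetPn.
  exists y; first by rewrite inE trile_refl trileW.
  rewrite inE (trileW xy) /=; apply/negP => /trile_neq/(_ y_z) yz.
  by have [_] := isol z y x zy z_y yz x_z x_y; rewrite xz.
exists x; first by rewrite inE trile_refl trileW.
rewrite inE (trileW xy) andbT; apply/negP => /trile_neq/(_ zx) z_x.
by have [] := isol z x y zx z_x xz y_z y_x; rewrite z_y.
Qed.

End Relations.

Theorem theorem7p8 (E : finType) (e : {set E * E}) (te : set_transitive e) :
  [<-> bounded_image_of_free (Reg te);
       semidistributive (Reg te);
       pseudocomplemented (Reg te);
       forall C : {set E}, C \in components e ->
         set_antisymmetric (restriction e C) \/
         exists a b : E,
           [/\ C = [set a; b], a <> b, (a, b) \in e & (b, a) \in e]].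
Proof.
tfae.
- exact: bounded_image_semidistributive.
- by case=> _; apply: meet_semidistributive_pseudocomplemented.
- by move=> /pseudocomplemented_isolated isol C; apply: isolated_component.
- move=> /component_isolated isol.
  exact: decreasing_bounded_image (interval_rank_decreasing te isol).
Qed.
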